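(* Let $d\ge1$ and $0<\alpha<d$. The function $N_1$ is given by $$N_1(x)=C_{d,\alpha}(x-2d)\qquad\text{for all }x>2d,$$ where $$C_{d,\alpha}=\lim_{L\to\infty}\frac{1}{L^{d-\alpha}}\sum_{n\in\Lambda_L}\frac{1}{b_n}.$$
   Context: $\{q_n\}_{n\in\mathbb{Z}^d}$ are i.i.d. random variables on a probability space $(\Omega,\mathcal{B}(\Omega),\mathbb{P})$, uniformly distributed on $[0,1]$. With $b_n=1+\|n\|_2^\alpha$, the random Schrödinger operator $H^\omega$ on $\ell^2(\mathbb{Z}^d)$ is defined on finitely supported $u$ by $(H^\omega u)(n)=\sum_{\|m-n\|_1=1}(u(n)-u(m))+b_nq_n(\omega)u(n)$. For $L\in\mathbb{N}$, $\Lambda_L=\{n\in\mathbb{Z}^d:|n_i|\le L\text{ for all }i\}$, and $H^\omega_{\Lambda_L}=(\langle\delta_n,H^\omega\delta_m\rangle)_{n,m\in\Lambda_L}$ is the compression of $H^\omega$ to $\ell^2(\Lambda_L)$. $N_L^\omega(E)$ is the number of eigenvalues (with multiplicity) of $H^\omega_{\Lambda_L}$ that are $\le E$. For $E>2d$, $N_1(E)=\lim_{L\to\infty}N_L^\omega(E)/L^{d-\alpha}$; it is known (Gordon–Jakšić–Molchanov–Simon) that this limit exists for a.e. $\omega$ and is a non-random continuous function of $E\in(2d,\infty)$. *)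

(* Defs.v *)
From HB Require Import structures.
From mathcomp Require Import all_boot all_order all_algebra.
From mathcomp Require Import finmap.
From mathcomp Require Import all_classical all_reals all_analysis.

Set Implicit Arguments.
Unset Strict Implicit.
Unset Printing Implicit Defensive.

Import Order.TTheory GRing.Theory Num.Theory.
Import numFieldNormedType.Exports.

Local Open Scope classical_set_scope.
Local Open Scope ring_scope.

Definition norm1 (d : nat) (n : 'rV[int]_d) : int := \sum_(i < d) `|n 0 i|.

Definition norm2 (R : realType) (d : nat) (n : 'rV[int]_d) : R :=
  Num.sqrt (\sum_(i < d) (n 0 i)%:~R ^+ 2).

(* At n = 0 the value is 1: since alpha > 0, [0 `^ alpha] is 0. *)
Definition b (R : realType) (d : nat) (alpha : R) (n : 'rV[int]_d) : R :=
  1 + norm2 R n `^ alpha.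

Definition neighbours (d : nat) (n : 'rV[int]_d) : set 'rV[int]_d :=
  [set m | norm1 (m - n) = 1].

Definition Lambda (d L : nat) : set 'rV[int]_d :=
  [set n | forall i : 'I_d, `|n 0 i| <= L%:Z].

(* [fset_set] is empty on infinite sets and [\sum_(_ \in _)] is 0 on families
   with infinite support; the next two facts exclude this for the sums over
   boxes and neighbours.  The other such sums are over the finite spectrum of a
   matrix and over products with a finitely supported function. *)
Lemma finite_Lambda (d L : nat) : finite_set (@Lambda d L).
Proof.
pose f (k : {ffun 'I_d -> 'I_(L + L).+1}) : 'rV[int]_d :=
  \row_i ((k i : nat)%:Z - L%:Z).
apply: (@sub_finite_set _ _ (f @` setT)); last first.
  exact/finite_image/finite_finset.
move=> n nL; exists [ffun i => inord `|(n 0 i + L%:Z)%R|%N] => //.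
apply/rowP => i; rewrite mxE ffunE.
have := nL i; rewrite ler_norml => /andP[h1 h2].
have h0 : 0 <= n 0 i + L%:Z by rewrite -lerBlDr sub0r.
rewrite inordK ?gez0_abs ?addrK//.
by rewrite ltnS -lez_nat gez0_abs// PoszD lerD2r.
Qed.

Lemma finite_neighbours (d : nat) (n : 'rV[int]_d) :
  finite_set (neighbours n).
Proof.
apply: (@sub_finite_set _ _ ((fun m => m + n) @` @Lambda d 1)); last first.
  exact/finite_image/finite_Lambda.
move=> m /= mn1; exists (m - n); last by rewrite subrK.
move=> i; rewrite -[leRHS]mn1 /norm1 (bigD1 i)//= lerDl.
by apply: sumr_ge0 => j _; exact: normr_ge0.
Qed.

(* The random Schroedinger operator at a fixed realization [v] of the
   variables [q_n].  All coefficients are real, so it is enough to work with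
   real-valued functions: the eigenvalues of the compressions, with their
   multiplicities, are the same over the reals and over the complex numbers. *)
Definition schrodinger (R : realType) (d : nat) (alpha : R)
    (v : 'rV[int]_d -> R) (u : 'rV[int]_d -> R) : 'rV[int]_d -> R :=
  fun n => \sum_(m \in neighbours n) (u n - u m) + b alpha n * v n * u n.

Definition delta (R : realType) (d : nat) (n : 'rV[int]_d) :
    'rV[int]_d -> R :=
  fun k => (k == n)%:R.

(* The inner product of l^2(Z^d), meant for products with finite support. *)
Definition dotp (R : realType) (d : nat) (u w : 'rV[int]_d -> R) : R :=
  \sum_(k \in [set: 'rV[int]_d]) u k * w k.

(* The sites of the box are numbered by [enum_val]. *)
Definition schrodinger_box (R : realType) (d : nat) (alpha : R)
    (v : 'rV[int]_d -> R) (L : nat) :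
    'M[R]_#|{: fset_set (@Lambda d L)}| :=
  \matrix_(i, j) dotp (delta R (val (enum_val i)))
                      (schrodinger alpha v (delta R (val (enum_val j)))).

(* The matrices this is applied to are symmetric, so the multiplicity of an
   eigenvalue is the dimension of its eigenspace. *)
Definition eigen_count (R : realType) (N : nat) (A : 'M[R]_N) (E : R) : nat :=
  \sum_(l \in [set l : R | eigenvalue A l /\ l <= E]) \rank (eigenspace A l).

(* N_L^omega(E) / L^(d - alpha) *)
Definition scaled_count (R : realType) (d : nat) (alpha : R)
    (v : 'rV[int]_d -> R) (E : R) (L : nat) : R :=
  (eigen_count (schrodinger_box alpha v L) E)%:R / L%:R `^ (d%:R - alpha).

Definition mutually_independent (R : realType) (disp : measure_display)
    (Omega : measurableType disp) (P : probability Omega R) (I : choiceType)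
    (X : I -> {RV P >-> R}) : Prop :=
  forall (J : {fset I}) (A : I -> set R), (forall i, measurable (A i)) ->
    P (\bigcap_(i in [set` J]) (X i @^-1` A i)) =
    (\prod_(i <- J) P (X i @^-1` A i))%E.

Definition uniform01 (R : realType) (disp : measure_display)
    (Omega : measurableType disp) (P : probability Omega R)
    (X : {RV P >-> R}) : Prop :=
  forall A : set R, measurable A ->
    distribution P X A = uniform_prob (@ltr01 R) A.

(* [N1] is the non-random continuous function on (2d, +oo) which is the almost
   sure limit of [N_L(E) / L^(d - alpha)].  The null set may depend on [E]. *)
Definition is_N1 (R : realType) (disp : measure_display)
    (Omega : measurableType disp) (P : probability Omega R) (d : nat)
    (alpha : R) (q : 'rV[int]_d -> {RV P >-> R}) (N1 : R -> R) : Prop :=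
  (forall E : R, (2 * d)%:R < E -> {for E, continuous N1}) /\
  (forall E : R, (2 * d)%:R < E ->
    {ae P, forall w : Omega,
      scaled_count alpha (fun n => q n w) E L @[L --> \oo] --> N1 E}).

(* The sequence whose limit is C_{d,alpha}. *)
Definition C_seq (R : realType) (d : nat) (alpha : R) (L : nat) : R :=
  (L%:R `^ (d%:R - alpha))^-1 * \sum_(n \in @Lambda d L) (b alpha n)^-1.

(* Main.v *)
Require Import Defs.
From HB Require Import structures.
From mathcomp Require Import all_boot all_order all_algebra.
From mathcomp Require Import finmap.
From mathcomp Require Import complex.
From mathcomp Require Import all_classical all_reals all_analysis.
From mathcomp Require Import measurable_realfun.
From mathcomp Require Import ring lra.

Set Implicit Arguments.
Unset Strict Implicit.
Unset Printing Implicit Defensive.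

Import Order.TTheory GRing.Theory Num.Theory.
Import numFieldNormedType.Exports.
Local Open Scope classical_set_scope.
Local Open Scope ring_scope.

(** Write the operator as [2d - A + V], with [A] the adjacency operator of the
    lattice and [V n = b n * q n], and put [a = E - 2d > 0].  Since [b n] grows,
    the potential is small only at rare sites, and two neighbours with small
    potential are rarer still.  A site surrounded by high potential barely feels
    [A], so the eigenvalues below [E] should be counted by the sites where
    [V n <= a]; the probability of this is [a / b n] as soon as [b n >= a], and
    summing it over the box gives [a * \sum 1 / b n].

    The comparison holds for every realization.  By the min-max principle
    ([eigen_count_ge_of_form], [eigen_count_le_of_form]) the number of
    eigenvalues is at least the number of low sites without low neighbours,
    because the form is diagonal on vectors living there
    ([low_sites_le_eigen_count]).  It is at most the number of sites with
    [V <= a + e], plus the number of pairs of neighbours whose potentials are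
    both below a level [K] that depends on [e]: on vectors vanishing at all
    these sites, a weighted AM-GM inequality on each edge absorbs [A] into [e]
    at the low end and into [K] at the high end ([eigen_count_le_low_sites]).

    With independent variables, the number of low sites is, by Chebyshev's
    inequality, within [o(L^(d-alpha))] of its mean, and this mean differs from
    [a * \sum 1 / b] by at most [a^2 * \sum 1 / b^2].  The mean number of low
    pairs is also at most a constant times [\sum 1 / b^2].  Because [b] tends to
    infinity, [\sum 1 / b^2] is negligible with respect to [\sum 1 / b], which
    is [O(L^(d-alpha))] ([sum_inv_b_le], [sum_inv_b_sqr_cvg0]).

    Hence, outside events whose probability tends to 0, the scaled eigenvalue
    count at [E] is close to [a * C_seq L], a deterministic quantity.  As the
    scaled count tends to [N1 E] almost surely, [a * C_seq L] tends to [N1 E]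
    ([eventually_of_ae], [scaled_count_limit]).  Only boundedness of [C_seq] is
    established directly: that it converges comes from the convergence of the
    eigenvalue counts, and [N1 E / (E - 2d)] is then the limit of one and the
    same sequence for all [E]. *)

(** * Counting eigenvalues with the quadratic form *)

(** The spectral theorem over [R[i]] diagonalizes [A] with real eigenvalues, and
    [real_similar] turns the complex change of basis into a real one. *)
Lemma symmetric_diagonalizable (R : rcfType) (N : nat) (A : 'M[R]_N) :
  A^T = A ->
  exists P : 'M[R]_N, exists D : 'rV[R]_N,
    P \in unitmx /\ P *m A = diag_mx D *m P.
Proof.
move=> Asym.
pose f := real_complex R.
pose Ac : 'M[R[i]]_N := map_mx f A.
have Acreal : Ac \is a mxOver Num.real.
  by apply/mxOverP => i j; rewrite mxE; apply/complex_realP; exists (A i j).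
have Acsym : Ac \is symmetricmx.
  apply/is_hermitianmxP; rewrite expr0 scale1r map_mx_id //.
  by apply/matrixP => i j; rewrite !mxE -[in LHS]Asym mxE.
have Aherm := realsym_hermsym Acsym Acreal.
have /orthomx_spectralP Aeq := hermitian_normalmx Aherm.
have Dreal := hermitian_spectral_diag_real Aherm.
have DMreal : diag_mx (spectral_diag Ac) \is a mxOver Num.real.
  apply/mxOverP => i j; rewrite mxE.
  by case: (i == j); rewrite ?mulr1n ?mulr0n ?real0 // (mxOverP Dreal).
have sim : similar_in unitmx Ac (diag_mx (spectral_diag Ac)).
  exists (spectralmx Ac); first exact: spectral_unit.
  apply/similarP; first exact: spectral_unit.
  by rewrite {2}Aeq !mulmxA mulmxV ?spectral_unit // mul1mx.
have [Q /andP[Qreal Qunit] /similarP QA] := real_similar sim Acreal DMreal.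
have {}QA := QA Qunit.
pose P : 'M[R]_N := map_mx (@complex.Re R) Q.
have QP : Q = map_mx f P.
  by apply/matrixP => i j; rewrite !mxE /f RRe_real //; apply: (mxOverP Qreal).
pose D : 'rV[R]_N := map_mx (@complex.Re R) (spectral_diag Ac).
have DD : spectral_diag Ac = map_mx f D.
  by apply/matrixP => i j; rewrite !mxE /f RRe_real //; apply: (mxOverP Dreal).
exists P, D; split; first by move: Qunit; rewrite QP map_unitmx.
have fI : injective f by exact: complexI.
move: QA; rewrite QP DD -map_diag_mx -!map_mxM => /matrixP h.
apply/matrixP => i j; apply: fI.
by have := h i j; rewrite ![in X in X -> _]mxE !mxE.
Qed.

(** Listing the spectrum makes sums over eigenvalues finite sums over ordinals;
    the last clause says that eigenvectors span the whole space. *)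
Lemma spectrum_exists (R : realType) (N : nat) (A : 'M[R]_N) :
  A^T = A ->
  exists s : seq R, [/\ uniq s, s =i eigenvalue A &
    (1%:M <= \sum_(i < size s) eigenspace A s`_i)%MS].
Proof.
move=> /symmetric_diagonalizable[P [D [Punit PA]]].
pose s := undup [seq D 0 i | i <- enum 'I_N].
have Dis i : D 0 i \in s by rewrite mem_undup; apply: map_f; rewrite mem_enum.
have rowA i : row i P *m A = D 0 i *: row i P.
  rewrite -row_mul PA.
  by apply/rowP => j; rewrite mul_diag_mx !mxE.
have sE : s =i eigenvalue A.
  move=> l; apply/idP/idP.
    rewrite mem_undup => /mapP[i _ ->].
    apply/eigenvalueP; exists (row i P) => //.
    apply/eqP => Pi0; have := mulmxV Punit => /(congr1 (row i)).
    rewrite row_mul Pi0 mul0mx => /matrixP /(_ 0 i).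
    by rewrite !mxE eqxx => /esym/eqP; rewrite oner_eq0.
  move=> /eigenvalueP[v vA v0].
  have [w wP] : exists w : 'rV_N, w *m P = v.
    by exists (v *m invmx P); rewrite mulmxKV.
  have wD : w *m diag_mx D = l *: w.
    rewrite -[LHS](mulmxK Punit) -[w *m _ *m _]mulmxA -PA mulmxA wP vA.
    by rewrite -scalemxAl -wP mulmxK.
  have w0 : w != 0 by apply: contra_neq v0 => w0; rewrite -wP w0 mul0mx.
  have /rV0Pn[i wi] := w0.
  have := wD => /matrixP/(_ 0 i); rewrite mul_mx_diag !mxE mulrC => Dl.
  rewrite -(mulIf wi Dl).
  exact: Dis.
exists s; split => //; first exact: undup_uniq.
have PS : (P <= \sum_(i < size s) eigenspace A s`_i)%MS.
  apply/row_subP => i.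
  have ip : (index (D 0%R i) s < size s)%N by rewrite index_mem.
  apply: (sumsmx_sup (Ordinal ip)) => //=.
  by apply/eigenspaceP; rewrite rowA nth_index.
apply: submx_trans PS; rewrite -(mulVmx Punit); exact: submxMl.
Qed.

Lemma eigen_count_seq (R : realType) (N : nat) (A : 'M[R]_N) (s : seq R)
    (E : R) :
  uniq s -> s =i eigenvalue A ->
  eigen_count A E =
  (\sum_(i < size s | (s`_i <= E)%R) \rank (eigenspace A s`_i))%N.
Proof.
move=> us sA; rewrite /eigen_count.
have -> : [set l : R | eigenvalue A l /\ l <= E] =
          [set` [seq l <- s | l <= E]].
  apply/seteqP; split => l /=; rewrite mem_filter sA.
    by move=> [? ->].
  by move=> /andP[].
rewrite -(@fsbig_seq _ _ addn) ?filter_uniq // big_filter.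
by rewrite (big_nth 0) big_mkord.
Qed.

Lemma mxdirect_eigenspaces (R : realType) (N : nat) (A : 'M[R]_N) (s : seq R)
    (Q : pred R) : uniq s ->
  mxdirect (\sum_(i < size s | Q s`_i) eigenspace A s`_i).
Proof.
move=> us; apply: mxdirect_sum_eigenspace => i j _ _ /eqP.
by rewrite nth_uniq // => /eqP/val_inj.
Qed.

(** Eigenvectors of a symmetric matrix for distinct eigenvalues are orthogonal,
    which makes the form of [A - E] diagonal on a sum of eigenspaces. *)
Lemma eigenspaces_form (R : realType) (N : nat) (A : 'M[R]_N) (s : seq R)
    (Q : pred R) (E : R) (u : 'rV[R]_N) : A^T = A -> uniq s ->
  (u <= \sum_(i < size s | Q s`_i) eigenspace A s`_i)%MS ->
  exists v : 'I_(size s) -> 'rV[R]_N,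
    u = \sum_(i < size s | Q s`_i) v i /\
    (u *m A *m u^T) 0 0 - E * (u *m u^T) 0 0 =
    \sum_(i < size s | Q s`_i) (s`_i - E) * (v i *m (v i)^T) 0 0.
Proof.
move=> Asym us uQ.
have [v [-> vA]] : exists v : 'I_(size s) -> 'rV[R]_N,
    u = \sum_(i < size s | Q s`_i) v i /\
    forall i, v i *m A = s`_i *: v i.
  have [w ->] := sub_sumsmxP uQ.
  exists (fun i => w i *m eigenspace A s`_i); split => // i.
  by apply/eigenspaceP; exact: submxMl.
exists v; split => //.
have vv i j : i != j -> v i *m (v j)^T = 0.
  move=> ij.
  have h : s`_i *: (v i *m (v j)^T) = s`_j *: (v i *m (v j)^T).
    rewrite scalemxAl -vA -mulmxA -{1}Asym -trmx_mul vA.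
    by rewrite linearZ /= scalemxAr.
  have : (s`_i - s`_j) *: (v i *m (v j)^T) == 0 by rewrite scalerBl h subrr.
  rewrite scaler_eq0 subr_eq0 nth_uniq // => /orP[/eqP/val_inj/eqP|/eqP//].
  by rewrite (negbTE ij).
rewrite mulmx_suml.
have e1 (c : 'I_(size s) -> R) :
    (\sum_(i < size s | Q s`_i) c i *: v i) *m
      (\sum_(i < size s | Q s`_i) v i)^T =
    \sum_(i < size s | Q s`_i) c i *: (v i *m (v i)^T).
  rewrite mulmx_suml; apply: eq_bigr => i Qi.
  rewrite linear_sum mulmx_sumr (bigD1 i) //= big1 ?addr0 ?scalemxAl //.
  by move=> j /andP[_ ji]; rewrite -scalemxAl (vv i j) 1?eq_sym // scaler0.
have e2 : (\sum_(i < size s | Q s`_i) v i) =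
          \sum_(i < size s | Q s`_i) 1 *: v i.
  by apply: eq_bigr => i _; rewrite scale1r.
under eq_bigr do rewrite vA.
rewrite e1 {1}e2 e1 !summxE mulr_sumr -sumrB; apply: eq_bigr => i Qi.
by rewrite scale1r mxE mulrBl.
Qed.

Lemma dotrr_ge0 (R : realType) (N : nat) (u : 'rV[R]_N) : 0 <= (u *m u^T) 0 0.
Proof. by rewrite mxE; apply: sumr_ge0 => i _; rewrite mxE -expr2 sqr_ge0. Qed.

Lemma dotrr_eq0 (R : realType) (N : nat) (u : 'rV[R]_N) :
  (u *m u^T) 0 0 = 0 -> u = 0.
Proof.
rewrite mxE => /eqP; rewrite psumr_eq0; last first.
  by move=> i _; rewrite mxE -expr2 sqr_ge0.
move=> /allP h; apply/rowP => i; have := h i (mem_index_enum _).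
by rewrite !mxE -expr2 sqrf_eq0 => /eqP.
Qed.

(** Restricting the vectors of [W] to the coordinates outside [S] lowers the
    dimension, so this restriction has a kernel. *)
Lemma supported_vector (F : fieldType) (m N : nat) (W : 'M[F]_(m, N))
    (S : {set 'I_N}) : (#|~: S| < \rank W)%N ->
  exists u : 'rV[F]_N,
    [/\ u != 0, (u <= W)%MS & forall i, i \notin S -> u 0 i = 0].
Proof.
move=> rW.
pose B : 'M[F]_(N, #|~: S|) := \matrix_(i, j) (i == enum_val j)%:R.
have := mxrank_mul_ker W B => h.
have : (W :&: kermx B)%MS != 0.
  rewrite -mxrank_eq0 -lt0n -(ltn_add2l (\rank (W *m B))) h addn0.
  exact: leq_ltn_trans (rank_leq_col _) rW.
move=> /rowV0Pn[u]; rewrite sub_capmx => /andP[uW /sub_kermxP uB] u0.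
exists u; split => // i iS.
have iS' : i \in ~: S by rewrite inE.
have := uB => /matrixP /(_ 0 (enum_rank_in iS' i)); rewrite !mxE.
rewrite (bigD1 i) //= big1 ?addr0.
  by rewrite mxE enum_rankK_in // eqxx mulr1.
by move=> j ji; rewrite mxE enum_rankK_in // (negbTE ji) mulr0.
Qed.

(** One half of the min-max principle: the eigenspaces up to [E] span a space on
    which the form of [A - E] is nonpositive; if its dimension exceeded [#|T|],
    it would contain a nonzero vector vanishing on [T]. *)
Lemma eigen_count_le_of_form (R : realType) (N : nat) (A : 'M[R]_N) (E : R)
    (T : {set 'I_N}) : A^T = A ->
  (forall u : 'rV[R]_N, u != 0 -> (forall i, i \in T -> u 0 i = 0) ->
    E * (u *m u^T) 0 0 < (u *m A *m u^T) 0 0) ->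
  (eigen_count A E <= #|T|)%N.
Proof.
move=> Asym h; have [s [us sA _]] := spectrum_exists Asym.
rewrite (eigen_count_seq E us sA) leqNgt; apply/negP => lt.
have := mxdirect_eigenspaces A (fun l => l <= E) us => /mxdirectP /= rk.
rewrite -rk in lt.
rewrite -[T]finset.setCK in lt.
have [u [u0 uW uT]] := supported_vector lt.
have [v [_ uv]] := @eigenspaces_form _ _ _ _ (fun l => l <= E) E _ Asym us uW.
have := h u u0; rewrite -subr_gt0 uv ltNge => /(_ _)/negP; apply.
  by move=> i iT; apply: uT; rewrite inE negbK.
apply: sumr_le0 => i Qi; rewrite mulr_le0_ge0 ?subr_le0 //.
exact: dotrr_ge0.
Qed.

(** The other half: the eigenspaces above [E] span all the remaining dimensions
    and the form of [A - E] is positive definite there, so they cannot contain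
    a nonzero vector supported in [S]. *)
Lemma eigen_count_ge_of_form (R : realType) (N : nat) (A : 'M[R]_N) (E : R)
    (S : {set 'I_N}) : A^T = A ->
  (forall u : 'rV[R]_N, (forall i, i \notin S -> u 0 i = 0) ->
    (u *m A *m u^T) 0 0 <= E * (u *m u^T) 0 0) ->
  (#|S| <= eigen_count A E)%N.
Proof.
move=> Asym h; have [s [us sA full]] := spectrum_exists Asym.
have rkN : (\sum_(i < size s) \rank (eigenspace A s`_i))%N = N.
  have := mxdirect_eigenspaces A predT us => /mxdirectP /= <-.
  by apply/eqP; move: full; rewrite sub1mx.
rewrite (eigen_count_seq E us sA) leqNgt; apply/negP => lt.
have lt' : (#|~: S| < \sum_(i < size s | ~~ (s`_i <= E)%R)
                       \rank (eigenspace A s`_i))%N.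
  have : (#|~: S| + #|S| <= N)%N by rewrite addnC cardsC card_ord.
  rewrite -[in leqRHS]rkN (bigID (fun i : 'I_(size s) => s`_i <= E)) /=.
  move=> le; rewrite -(ltn_add2r #|S|); apply: leq_ltn_trans le _.
  by rewrite addnC ltn_add2l.
have := mxdirect_eigenspaces A (fun l => ~~ (l <= E)) us => /mxdirectP /= rk.
rewrite -rk in lt'.
have [u [u0 uW uS]] := supported_vector lt'.
have [v [uE uv]] :=
  @eigenspaces_form _ _ _ _ (fun l => ~~ (l <= E)) E _ Asym us uW.
have := h u uS; rewrite -subr_le0 uv => le0.
have v0 (i : 'I_(size s)) : ~~ (s`_i <= E) -> v i = 0.
  have pos (j : 'I_(size s)) :
      ~~ (s`_j <= E) -> 0 <= (s`_j - E) * (v j *m (v j)^T) 0 0.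
    by rewrite -ltNge => Ej; rewrite mulr_ge0 ?dotrr_ge0 // subr_ge0 ltW.
  have /eqP : \sum_(j < size s | ~~ (s`_j <= E))
      (s`_j - E) * (v j *m (v j)^T) 0 0 = 0.
    by apply/eqP; rewrite eq_le le0 sumr_ge0.
  rewrite psumr_eq0 // => /allP/(_ i (mem_index_enum _))/implyP h0 Ei.
  have := h0 Ei; rewrite mulf_eq0 subr_eq0 => /orP[/eqP sE|/eqP/dotrr_eq0//].
  by move: Ei; rewrite sE lexx.
by move: u0; rewrite uE big1 ?eqxx.
Qed.

(** * Matrices of the form degree minus adjacency plus potential *)

(** The diagonal carries the same [D] at every site, even where fewer than [D]
    neighbours are present: this is how the compression of an operator on the
    whole lattice differs from the Laplacian of the box. *)
Definition graph_schrodinger (R : realType) (N : nat) (D : R)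
    (adj : rel 'I_N) (V : 'I_N -> R) : 'M[R]_N :=
  \matrix_(i, j) ((i == j)%:R * (D + V i) - (adj i j)%:R).

Definition low_sites (R : realType) (N : nat) (V : 'I_N -> R) (a : R) :
    {set 'I_N} := [set i | V i <= a].

Definition low_pairs (R : realType) (N : nat) (adj : rel 'I_N)
    (V : 'I_N -> R) (a : R) : {set 'I_N * 'I_N} :=
  [set p | [&& adj p.1 p.2, V p.1 <= a & V p.2 <= a]].

Lemma graph_schrodinger_sym (R : realType) (N : nat) (D : R)
    (adj : rel 'I_N) (V : 'I_N -> R) : symmetric adj ->
  (graph_schrodinger D adj V)^T = graph_schrodinger D adj V.
Proof.
move=> s; apply/matrixP => i j; rewrite !mxE s eq_sym; congr (_ - _).
by case: eqP => [->//|_]; rewrite !mul0r.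
Qed.

Lemma graph_schrodinger_form (R : realType) (N : nat) (D : R)
    (adj : rel 'I_N) (V : 'I_N -> R) (u : 'rV[R]_N) : symmetric adj ->
  (u *m graph_schrodinger D adj V *m u^T) 0 0 =
  \sum_i (D + V i) * u 0 i ^+ 2 -
  \sum_i \sum_j (adj i j)%:R * (u 0 i * u 0 j).
Proof.
move=> s; rewrite mxE -sumrB; apply: eq_bigr => i _.
rewrite !mxE mulr_suml (bigD1 i) //=.
rewrite [in RHS](bigD1 i) //= opprD addrA; congr (_ + _).
  by rewrite mxE eqxx mul1r; ring.
rewrite -sumrN; apply: eq_bigr => j ji.
by rewrite mxE (negbTE ji) s mul0r; ring.
Qed.

Lemma form1E (R : realType) (N : nat) (u : 'rV[R]_N) :
  (u *m u^T) 0 0 = \sum_i u 0 i ^+ 2.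
Proof. by rewrite mxE; apply: eq_bigr => i _; rewrite mxE expr2. Qed.

Definition clustered_sites (R : realType) (N : nat) (adj : rel 'I_N)
    (V : 'I_N -> R) (a : R) : {set 'I_N} :=
  [set i | (V i <= a) && [exists j, adj i j && (V j <= a)]].

Lemma card_clustered_sites_le (R : realType) (N : nat) (adj : rel 'I_N)
    (V : 'I_N -> R) (K : R) :
  (#|clustered_sites adj V K| <= #|low_pairs adj V K|)%N.
Proof.
apply: leq_trans (leq_imset_card fst _); apply: subset_leq_card.
apply/fintype.subsetP => i; rewrite inE => /andP[Vi /existsP[j /andP[ij Vj]]].
by apply/imsetP; exists (i, j) => //; rewrite inE /= ij Vi Vj.
Qed.

(** Test vectors living on the low sites without low neighbours: no edge joins
    two sites of their support, so the form reduces to its diagonal part, which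
    is at most [D + a]. *)
Lemma low_sites_le_eigen_count (R : realType) (N : nat) (D : R)
    (adj : rel 'I_N) (V : 'I_N -> R) (a K : R) : symmetric adj -> a <= K ->
  (#|low_sites V a| <= eigen_count (graph_schrodinger D adj V) (D + a) +
                       #|low_pairs adj V K|)%N.
Proof.
move=> s aK.
pose B := clustered_sites adj V K.
have le1 : (#|low_sites V a| <= #|low_sites V a :\: B| + #|B|)%N.
  rewrite -[in leqLHS](cardsID B (low_sites V a)) [leqLHS]addnC leq_add2l.
  by rewrite subset_leq_card // finset.subsetIr.
apply: (leq_trans le1); apply: leq_add; last exact: card_clustered_sites_le.
apply: eigen_count_ge_of_form; first exact: graph_schrodinger_sym.
move=> u uS; rewrite graph_schrodinger_form // form1E mulr_sumr.
rewrite [X in _ - X]big1 => [|i _].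
  rewrite subr0; apply: ler_sum => i _.
  have [|/uS ->] := boolP (i \in low_sites V a :\: B); last first.
    by rewrite expr0n !mulr0.
  by rewrite !inE => /andP[_ Vi]; rewrite ler_wpM2r ?sqr_ge0 // lerD2l.
apply: big1 => j _.
have [|/uS ->] := boolP (i \in low_sites V a :\: B); last first.
  by rewrite mul0r mulr0.
have [|/uS ->] := boolP (j \in low_sites V a :\: B); last by rewrite !mulr0.
rewrite !inE => /andP[_ Vj] /andP[iB Vi].
case: (boolP (adj i j)) => [ij|_]; last by rewrite mul0r.
case/negP: iB; rewrite (le_trans Vi aK) /=; apply/existsP; exists j.
by rewrite ij (le_trans Vj aK).
Qed.

(** The factor [(D + e + 1) / e] is the inverse of a weight [h <= 1] with
    [D * h < e].  In the AM-GM inequality on an edge joining a low to a high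
    site, the low end gets weight [h], which costs less than [e] over all its
    edges, and the high end gets weight [1 / h]. *)
Definition high_level (R : realType) (D a e : R) : R :=
  a + D * ((D + e + 1) / e).

Lemma high_level_ge (R : realType) (D a e : R) :
  0 <= D -> 0 < e -> a <= high_level D a e.
Proof.
move=> D0 /ltW e0; rewrite lerDl mulr_ge0 // divr_ge0 //.
by rewrite !addr_ge0.
Qed.

(** On vectors vanishing on the sites up to [a + e] and on the clustered sites,
    every edge that matters has a high end.  The weights described at
    [high_level] bound the adjacency term by a diagonal one, which leaves a
    positive coefficient at each remaining site. *)
Lemma eigen_count_le_low_sites (R : realType) (N : nat) (D : R)
    (adj : rel 'I_N) (V : 'I_N -> R) (a e : R) : symmetric adj ->
  0 <= D -> 0 < e -> (forall i, \sum_j (adj i j)%:R <= D) ->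
  (eigen_count (graph_schrodinger D adj V) (D + a) <=
    #|low_sites V (a + e)| + #|low_pairs adj V (high_level D a e)|)%N.
Proof.
move=> s D0 e0 deg; set K := high_level D a e.
pose B := clustered_sites adj V K.
apply: (@leq_trans #|low_sites V (a + e) :|: B|); last first.
  apply: leq_trans (leq_add (leqnn _) (card_clustered_sites_le adj V K)).
  by rewrite -cardsUI leq_addr.
apply: eigen_count_le_of_form; first exact: graph_schrodinger_sym.
move=> u u0 uT; rewrite graph_schrodinger_form // form1E mulr_sumr.
pose h := e / (D + e + 1).
have De : 0 < D + e + 1 by rewrite addr_gt0 // ltr_wpDl.
have h0 : 0 < h by rewrite divr_gt0.
have h1 : h <= 1 by rewrite ler_pdivrMr // mul1r; lra.
have hV1 : 1 <= h^-1 by rewrite invf_ge1.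
have Dh : D * h < e.
  by rewrite mulrA ltr_pdivrMr // mulrC ltr_pM2l //; lra.
(* the weight of site [i] on each of its edges *)
pose c i := if V i <= K then h else h^-1.
have pairle i j : (adj i j)%:R * (u 0 i * u 0 j) <=
    (adj i j)%:R * (c i * u 0 i ^+ 2 / 2) +
    (adj i j)%:R * (c j * u 0 j ^+ 2 / 2).
  rewrite -mulrDr; case: (boolP (adj i j)) => [ij|_]; last by rewrite !mul0r.
  rewrite !mul1r.
  have amgm (x y : R) : x * y <= h * x ^+ 2 / 2 + h^-1 * y ^+ 2 / 2.
    have : 0 <= (h * x - y) ^+ 2 / h by rewrite divr_ge0 ?sqr_ge0 // ltW.
    have -> : (h * x - y) ^+ 2 / h =
        2 * (h * x ^+ 2 / 2 + h^-1 * y ^+ 2 / 2 - x * y).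
      by field; rewrite gt_eqF.
    lra.
  rewrite /c; case: ifPn => Vi; case: ifPn => Vj.
  (* two low neighbours are clustered, so [u] vanishes there *)
  - rewrite (uT i).
      rewrite !(mul0r, expr0n, mulr0, add0r) /= ?mulr0n ?mulr0 ?mul0r ?add0r.
      by rewrite mulr_ge0 // mulr_ge0 ?sqr_ge0 ?ltW.
    rewrite !inE Vi /=; apply/orP; right; apply/existsP; exists j.
    by rewrite ij.
  - exact: amgm.
  - by rewrite mulrC addrC; exact: amgm.
  - have : u 0 i * u 0 j <= u 0 i ^+ 2 / 2 + u 0 j ^+ 2 / 2.
      have := sqr_ge0 (u 0 i - u 0 j); rewrite sqrrB; lra.
    have := ler_wpM2r (sqr_ge0 (u 0 i)) hV1.
    have := ler_wpM2r (sqr_ge0 (u 0 j)) hV1.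
    lra.
have sumle : \sum_i \sum_j (adj i j)%:R * (u 0 i * u 0 j) <=
             \sum_i D * c i * u 0 i ^+ 2.
  have c0 i : 0 <= c i by rewrite /c; case: ifP => _; rewrite ?invr_ge0 ltW.
  have half : \sum_i \sum_j (adj i j)%:R * (c i * u 0 i ^+ 2 / 2) <=
              \sum_i D * c i * u 0 i ^+ 2 / 2.
    apply: ler_sum => i _; rewrite -mulr_suml.
    have -> : D * c i * u 0 i ^+ 2 / 2 = D * (c i * u 0 i ^+ 2 / 2) by ring.
    by rewrite ler_wpM2r // divr_ge0 // mulr_ge0 // sqr_ge0.
  apply: (@le_trans _ _ (\sum_i \sum_j ((adj i j)%:R * (c i * u 0 i ^+ 2 / 2) +
      (adj i j)%:R * (c j * u 0 j ^+ 2 / 2)))).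
    by apply: ler_sum => i _; apply: ler_sum => j _.
  under eq_bigr do rewrite big_split /=.
  rewrite big_split /= [X in _ + X]exchange_big /=.
  under [X in _ + X]eq_bigr do under eq_bigr do rewrite s.
  apply: le_trans (lerD half half) _.
  by rewrite -big_split /=; apply: ler_sum => i _; lra.
rewrite -subr_gt0 -sumrB.
suff : 0 < \sum_i (V i - a - D * c i) * u 0 i ^+ 2.
  have -> : \sum_i (V i - a - D * c i) * u 0 i ^+ 2 =
      \sum_i ((D + V i) * u 0 i ^+ 2 - (D + a) * u 0 i ^+ 2) -
      \sum_i D * c i * u 0 i ^+ 2.
    by rewrite -sumrB; apply: eq_bigr => i _; ring.
  rewrite !sumrB; lra.
have pos i : i \notin low_sites V (a + e) :|: B -> 0 < V i - a - D * c i.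
  rewrite !inE negb_or -ltNge => /andP[Vi _]; rewrite /c; case: ifPn => [_|].
    lra.
  rewrite -ltNge /K /high_level -[(D + e + 1) / e]invrK invf_div -/h; lra.
have nonneg i : 0 <= (V i - a - D * c i) * u 0 i ^+ 2.
  have [/uT ->|/pos/ltW ?] := boolP (i \in low_sites V (a + e) :|: B).
    by rewrite expr0n mulr0.
  by rewrite mulr_ge0 ?sqr_ge0.
have /rV0Pn[i ui] := u0.
have iT : i \notin low_sites V (a + e) :|: B.
  by apply: contra ui => /uT ->.
rewrite (bigD1 i) //= ltr_pwDl ?sumr_ge0 // mulr_gt0 ?pos //.
by rewrite exprn_even_gt0.
Qed.

(** * The compression to a box *)

Definition unit_step (d : nat) (p : 'I_d * bool) : 'rV[int]_d :=
  (-1) ^+ p.2 *: delta_mx 0 p.1.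

Lemma unit_step_inj (d : nat) : injective (@unit_step d).
Proof.
move=> [i e] [j f] /rowP h.
have := h i; rewrite /unit_step !mxE /= eqxx mulr1.
have [ij|ij] := eqVneq i j; last by move=> /eqP; rewrite mulr0 signr_eq0.
by rewrite mulr1 => /eqP; rewrite (inj_eq signr_inj) => /eqP ->; rewrite ij.
Qed.

Lemma norm1_unit_step (d : nat) (p : 'I_d * bool) : norm1 (unit_step p) = 1.
Proof.
rewrite /norm1 (bigD1 p.1) //= big1 => [|j jp].
  by rewrite !mxE !eqxx /= mulr1 normr_sign addr0.
by rewrite !mxE (negbTE jp) andbF mulr0 normr0.
Qed.

Lemma norm1_eq1 (d : nat) (x : 'rV[int]_d) : norm1 x = 1 ->
  exists p, x = unit_step p.
Proof.
move=> x1; have [i xi] : exists i, x 0 i != 0.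
  apply/existsP; apply: contra_eqT x1; rewrite negb_exists => /forallP h.
  rewrite /norm1 big1 // => i _; apply/eqP; rewrite normr_eq0.
  by have := h i; rewrite negbK.
have xi1 : 1 <= `|x 0 i| by rewrite -gtz0_ge1 normr_gt0.
move: x1; rewrite /norm1 (bigD1 i) //=.
have s0 : 0 <= \sum_(j < d | j != i) `|x 0 j| by apply: sumr_ge0.
move=> x1.
have sum0 : \sum_(j < d | j != i) `|x 0 j| = 0.
  by apply/eqP; rewrite eq_le s0 andbT -(lerD2l `|x 0 i|) x1 addr0.
have xi1' : `|x 0 i| = 1 by rewrite -[LHS]addr0 -sum0.
exists (i, x 0 i < 0); apply/rowP => j; rewrite !mxE /=.
have [->|ji] := eqVneq j i.
  by rewrite [LHS]numEsign xi1'.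
rewrite mulr0; move/eqP: sum0; rewrite psumr_eq0 //.
by move=> /allP /(_ j (mem_index_enum _)); rewrite ji normr_eq0 => /eqP.
Qed.

Lemma norm1N (d : nat) (x : 'rV[int]_d) : norm1 (- x) = norm1 x.
Proof. by apply: eq_bigr => i _; rewrite mxE normrN. Qed.

Lemma card_neighbours (d : nat) (n : 'rV[int]_d) :
  #|` fset_set (neighbours n)| = (2 * d)%N.
Proof.
pose s := [seq n + unit_step p | p <- enum {: 'I_d * bool}].
have us : uniq s.
  by rewrite map_inj_uniq ?enum_uniq // => p q /addrI /unit_step_inj.
have ss : s =i fset_set (neighbours n).
  move=> m; rewrite in_fset_set; last exact: finite_neighbours.
  apply/mapP/idP => [[p _ ->]|].
    by rewrite inE /neighbours /= addrAC subrr add0r norm1_unit_step.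
  rewrite inE => /norm1_eq1[p mp]; exists p; first by rewrite mem_enum.
  by rewrite -mp addrC subrK.
have := perm_size (uniq_perm us (fset_uniq _) ss).
by rewrite size_map -cardE card_prod card_ord card_bool mulnC => ->.
Qed.

(** The numbering of the box used for the rows of [schrodinger_box]. *)
Definition site (d L : nat) (i : 'I_#|{: fset_set (@Lambda d L)}|) :
  'rV[int]_d := val (enum_val i).

Lemma site_inj (d L : nat) : injective (@site d L).
Proof. by move=> i j /val_inj /enum_val_inj. Qed.

Lemma site_Lambda (d L : nat) (i : 'I_#|{: fset_set (@Lambda d L)}|) :
  Lambda L (site i).
Proof.
have := valP (enum_val i); rewrite /= in_fset_set ?inE //.
exact: finite_Lambda.
Qed.

Lemma sum_Lambda (V : nmodType) (d L : nat) (f : 'rV[int]_d -> V) :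
  \sum_(n \in @Lambda d L) f n =
  \sum_(i < #|{: fset_set (@Lambda d L)}|) f (site i).
Proof.
rewrite fsbig_finite /=; last exact: finite_Lambda.
rewrite [LHS]big_seq_fsetE /=.
exact: (big_enum_val (fun x : {: fset_set (@Lambda d L)} => f (val x))).
Qed.

Definition site_adj (d L : nat) : rel 'I_#|{: fset_set (@Lambda d L)}| :=
  [rel i j | norm1 (site i - site j) == 1].

Lemma site_adj_sym (d L : nat) : symmetric (@site_adj d L).
Proof. by move=> i j; rewrite /site_adj /= -norm1N opprB. Qed.

Definition site_potential (R : realType) (d : nat) (alpha : R)
    (v : 'rV[int]_d -> R) (L : nat)
    (i : 'I_#|{: fset_set (@Lambda d L)}|) : R :=
  b alpha (site i) * v (site i).

Lemma site_degree (R : realType) (d L : nat)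
    (i : 'I_#|{: fset_set (@Lambda d L)}|) :
  \sum_j (site_adj i j)%:R <= (2 * d)%:R :> R.
Proof.
rewrite -natr_sum ler_nat -(card_neighbours (site i)).
have -> : (\sum_j site_adj i j)%N = #|(finset (site_adj i))|.
  rewrite -sum1_card [RHS]big_mkcond /=; apply: eq_bigr => j _.
  by rewrite finset.in_set; case: (site_adj i j).
rewrite cardE -(size_map (@site d L)); apply: uniq_leq_size.
  by rewrite map_inj_uniq ?enum_uniq //; exact: site_inj.
move=> m /mapP[j]; rewrite mem_enum inE => ij ->.
rewrite in_fset_set ?inE; last exact: finite_neighbours.
by apply/eqP; move: ij; rewrite /site_adj /= -norm1N opprB.
Qed.

Lemma dotp_delta (R : realType) (d : nat) (n : 'rV[int]_d)
  (w : 'rV[int]_d -> R) : dotp (delta R n) w = w n.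
Proof.
rewrite /dotp (@fsbigTE _ _ _ _ [fset n]%fset) => [|k]; last first.
  by rewrite /delta inE => /negbTE ->; rewrite mul0r.
by rewrite big_seq_fset1 /delta eqxx mul1r.
Qed.

Lemma schrodinger_boxE (R : realType) (d : nat) (alpha : R)
    (v : 'rV[int]_d -> R) (L : nat) :
  schrodinger_box alpha v L =
  graph_schrodinger (2 * d)%:R (@site_adj d L) (@site_potential R d alpha v L).
Proof.
apply/matrixP => i j; rewrite !mxE dotp_delta /schrodinger.
rewrite -/(site i) -/(site j).
rewrite fsbig_finite /=; last exact: finite_neighbours.
have dE : delta R (site j) (site i) = (i == j)%:R.
  by rewrite /delta (inj_eq (@site_inj _ _)).
rewrite sumrB dE.
have -> : \sum_(m <- fset_set (neighbours (site i))) (i == j)%:R =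
    (i == j)%:R * (2 * d)%:R :> R.
  by rewrite big_const_seq count_predT card_neighbours iter_addr_0 mulr_natr.
have -> : \sum_(m <- fset_set (neighbours (site i))) delta R (site j) m =
   (site_adj i j)%:R.
  have adjE : site_adj i j = (site j \in fset_set (neighbours (site i))).
    rewrite in_fset_set; last exact: finite_neighbours.
    by rewrite site_adj_sym; apply/idP/idP; rewrite inE => /eqP.
  rewrite adjE; case: (boolP (site j \in _)) => [jn|jn].
    rewrite (bigD1_seq (site j)) ?fset_uniq //= big1 /delta ?eqxx ?addr0 //.
    by move=> m /negbTE ->.
  rewrite big_seq big1 // => m mn; rewrite /delta.
  by case: eqP => // mj; move: jn; rewrite -mj mn.
rewrite /site_potential; ring.
Qed.

(** * Sums of powers of 1/b over a box *)

(** Young's inequality for [y^t] and 1, with exponents [1/t] and [1/(1-t)]. *)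
Lemma powR_bernoulli (R : realType) (t y : R) : 0 < t < 1 -> 0 <= y ->
  y `^ t <= 1 + t * (y - 1).
Proof.
move=> /andP[t0 t1] y0.
have t1' : 0 < 1 - t by rewrite subr_gt0.
have := @conjugate_powR R (y `^ t) 1 t^-1 (1 - t)^-1 (powR_ge0 _ _) ler01.
rewrite !invr_gt0 !invrK t0 t1' powR1 -powRrM mulfV ?gt_eqF // powRr1 //.
rewrite mulr1 => /(_ isT isT); have -> : t + (1 - t) = 1 by ring.
move=> /(_ erefl); lra.
Qed.

(** By Bernoulli's inequality, each term [x^(t-1)] is at most the increment of
    [x^t / t] between [x - 1] and [x], so the sum telescopes. *)
Lemma sum_powRN (R : realType) (t : R) (L : nat) : 0 < t < 1 ->
  \sum_(j < L.+1) (Num.max 1 (j : nat)%:R) `^ (- (1 - t)) <=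
  1 + L%:R `^ t / t.
Proof.
move=> t01; have /andP[t0 t1] := t01.
elim: L => [|L IH].
  rewrite big_ord_recl big_ord0 /= addr0 max_l // powR1.
  by rewrite lerDl divr_ge0 ?powR_ge0 // ltW.
rewrite big_ord_recr /=; apply: le_trans (lerD IH (lexx _)) _.
rewrite max_r ?ler1n // -addrA lerD2l.
rewrite -lerBrDl -mulrBl ler_pdivlMr //.
set x : R := L.+1%:R.
have x0 : 0 < x by rewrite ltr0n.
have xL : L%:R = x * (L%:R / x) by rewrite mulrC divfK ?gt_eqF.
rewrite xL powRM ?divr_ge0 ?(ltW x0) //.
have := powR_bernoulli t01 (divr_ge0 (ler0n _ L) (ltW x0)).
have -> : L%:R / x - 1 = - x^-1.
  by rewrite /x -natr1; field; rewrite natr1 gt_eqF.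
have -> : x `^ (- (1 - t)) = x `^ t / x.
  rewrite opprB powRB; last by apply/implyP => _; rewrite gt_eqF.
  by rewrite powRr1 // ltW.
have xt := powR_gt0 t x0.
rewrite -(ler_pM2l xt) => h.
rewrite lerBrDr -lerBrDl; apply: le_trans h _; rewrite le_eqVlt.
by apply/orP; left; apply/eqP; ring.
Qed.

Lemma norm2_ge (R : realType) (d : nat) (n : 'rV[int]_d) (i : 'I_d) :
  (`|n 0 i|)%:~R <= norm2 R n.
Proof.
rewrite /norm2 -[leLHS]ger0_norm ?ler0z // -sqrtr_sqr ler_sqrt; last first.
  by apply: sumr_ge0 => j _; rewrite sqr_ge0.
rewrite (bigD1 i) //= -[X in X <= _]addr0 lerD ?sumr_ge0 //.
  by rewrite intr_norm real_normK ?num_real.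
by move=> j _; rewrite sqr_ge0.
Qed.

Lemma b_ge1 (R : realType) (d : nat) (alpha : R) (n : 'rV[int]_d) :
  1 <= b alpha n.
Proof. by rewrite /b lerDl powR_ge0. Qed.

Lemma b_gt0 (R : realType) (d : nat) (alpha : R) (n : 'rV[int]_d) :
  0 < b alpha n.
Proof. exact: lt_le_trans ltr01 (b_ge1 _ _). Qed.

Definition sum_inv_b (R : realType) (d : nat) (alpha : R) (L : nat) : R :=
  \sum_(i < #|{: fset_set (@Lambda d L)}|) (b alpha (site i))^-1.

Definition sum_inv_b_sqr (R : realType) (d : nat) (alpha : R) (L : nat) : R :=
  \sum_(i < #|{: fset_set (@Lambda d L)}|) (b alpha (site i))^-1 ^+ 2.

Definition count_scale (R : realType) (d : nat) (alpha : R) (L : nat) : R :=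
  L%:R `^ (d%:R - alpha).

Definition axis_weight (R : realType) (s : R) (k : nat) : R :=
  Num.max 1 k%:R `^ (- s).

(** Each coordinate is at most the Euclidean norm, so a product of [d] powers
    [alpha / d] of the coordinates is at most a power [alpha] of the norm.  This
    splits the sum over the box into one-dimensional sums; the maximum with 1
    takes care of vanishing coordinates. *)
Lemma inv_b_le_prod (R : realType) (d : nat) (alpha : R) (n : 'rV[int]_d) :
  (0 < d)%N -> 0 < alpha ->
  (b alpha n)^-1 <= \prod_(i < d) axis_weight (alpha / d%:R) `|n 0%R i|%N.
Proof.
move=> d0 a0; set s := alpha / d%:R.
have s0 : 0 < s by rewrite divr_gt0 // ltr0n.
rewrite /axis_weight; under eq_bigr do rewrite powRN.
rewrite prodfV lef_pV2 ?posrE ?b_gt0 //; last first.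
  by apply: prodr_gt0 => i _; rewrite powR_gt0 // lt_max ltr01.
have n20 : 0 <= norm2 R n by exact: sqrtr_ge0.
apply: (@le_trans _ _ (\prod_(i < d) (Num.max 1 (norm2 R n)) `^ s)).
  apply: ler_prod => i _; rewrite powR_ge0 /=.
  apply: ge0_ler_powR; [exact: ltW | by rewrite nnegrE le_max ler01
    | by rewrite nnegrE le_max ler01 |].
  rewrite ge_max le_max lexx /= le_max; apply/orP; right.
  by apply: le_trans (norm2_ge R n i); rewrite -abszE.
rewrite prodr_const card_ord -powR_mulrn ?powR_ge0 // -powRrM.
rewrite divfK ?pnatr_eq0 -?lt0n // /b.
rewrite /Num.max; case: ifP => _; first by rewrite lerDr.
by rewrite powR1 lerDl powR_ge0.
Qed.

Lemma ler_sum_inj (R : numDomainType) (I J : finType) (h : I -> J)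
    (F : J -> R) :
  injective h -> (forall j, 0 <= F j) -> \sum_i F (h i) <= \sum_j F j.
Proof.
move=> hI F0; have -> : \sum_i F (h i) = \sum_(j in [set h i | i in I]%SET) F j.
  by rewrite big_imset //= => i j _ _ /hI.
rewrite [leLHS]big_mkcond; apply: ler_sum => j _.
by case: ifP.
Qed.

(** The growth rate [L^(d - alpha)] is the product of [d] one-dimensional sums,
    each of order [L^(1 - alpha / d)]. *)
Lemma sum_inv_b_le (R : realType) (d : nat) (alpha : R) :
  (0 < d)%N -> 0 < alpha -> alpha < d%:R ->
  exists2 M : R, 0 <= M & forall L, (0 < L)%N ->
    sum_inv_b d alpha L <= M * count_scale d alpha L.
Proof.
move=> d0 a0 ad; pose s := alpha / d%:R; pose t := 1 - s.
have d0' : 0 < d%:R :> R by rewrite ltr0n.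
have t01 : 0 < t < 1.
  by rewrite subr_gt0 ltrBlDr ltrDl ltr_pdivrMr // mul1r ad divr_gt0.
have /andP[t0 t1] := t01.
exists ((2 * (1 + t^-1)) ^+ d) => [|L L0].
  by rewrite exprn_ge0 // mulr_ge0 // addr_ge0 // invr_ge0 ltW.
pose N := #|{: fset_set (@Lambda d L)}|.
(* a coordinate is encoded by its absolute value and its sign *)
pose h (i : 'I_N) : {ffun 'I_d -> 'I_L.+1 * bool} :=
  [ffun k => (inord `|site i 0%R k|%N, site i 0 k < 0)].
have siteL (i : 'I_N) k : (`|site i 0%R k| < L.+1)%N.
  by rewrite ltnS -lez_nat abszE; exact: site_Lambda.
have hI : injective h.
  move=> i j /ffunP hij; apply/site_inj/rowP => k.
  have := hij k; rewrite !ffunE => -[/(congr1 val)].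
  rewrite /= !inordK ?siteL // => e1 e2.
  by rewrite [LHS]numEsign [RHS]numEsign -!abszE e1 e2.
pose F (f : {ffun 'I_d -> 'I_L.+1 * bool}) : R :=
  \prod_(k < d) axis_weight s (f k).1.
apply: (@le_trans _ _ (\sum_(i < N) F (h i))).
  apply: ler_sum => i _; apply: le_trans (inv_b_le_prod _ d0 a0) _.
  by apply: ler_prod => k _; rewrite powR_ge0 /= ffunE /= inordK ?siteL.
apply: le_trans (ler_sum_inj hI _) _.
  by move=> f; apply: prodr_ge0 => k _; exact: powR_ge0.
rewrite /F -(bigA_distr_bigA (fun _ p => axis_weight s (p.1 : 'I_L.+1))) /=.
rewrite prodr_const card_ord.
have -> : count_scale d alpha L = (L%:R `^ t) ^+ d.
  rewrite /count_scale -powR_mulrn ?powR_ge0 // -powRrM; congr (_ `^ _).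
  by rewrite /t /s; field; rewrite gt_eqF.
rewrite -exprMn; apply: lerXn2r; rewrite ?nnegrE.
- by apply: sumr_ge0 => p _; exact: powR_ge0.
- by rewrite !mulr_ge0 ?powR_ge0 // addr_ge0 // invr_ge0 ltW.
rewrite -(pair_big xpredT xpredT
  (fun (j : 'I_L.+1) (_ : bool) => axis_weight s j)) /=.
under eq_bigr do rewrite big_const card_bool iter_addr_0.
rewrite sumrMnl -[leLHS]mulr_natl -mulrA ler_pM2l //.
have := sum_powRN L t01; rewrite {1}/t.
have -> : - (1 - (1 - s)) = - s by ring.
move=> /le_trans; apply.
rewrite mulrDl mul1r lerD //; last by rewrite mulrC.
have := @ler_powR _ L%:R (_ : 1 <= L%:R) 0 t (ltW t0).
by rewrite powRr0 ler1n; apply.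
Qed.

(** Outside a box depending only on [e], [1 / b <= e] and so [1 / b^2 <= e / b];
    [M] is the number of sites of that box, where [1 / b^2 <= 1]. *)
Lemma sum_inv_b_sqr_le (R : realType) (d : nat) (alpha e : R) :
  0 < alpha -> 0 < e ->
  exists2 M : R, 0 <= M & forall L,
    sum_inv_b_sqr d alpha L <= e * sum_inv_b d alpha L + M.
Proof.
move=> a0 e0.
pose L0 := Num.bound (e^-1 `^ alpha^-1).
exists #|` fset_set (@Lambda d L0)|%:R => // L.
pose N := #|{: fset_set (@Lambda d L)}|.
have out (n : 'rV[int]_d) :
    n \notin fset_set (@Lambda d L0) -> (b alpha n)^-1 <= e.
  rewrite in_fset_set; last exact: finite_Lambda.
  move=> nL; have [i ni] : exists i, L0%:Z < `|n 0 i|.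
    apply/existsP; apply: contraNT nL; rewrite negb_exists => /forallP h.
    by rewrite inE => i; rewrite leNgt h.
  rewrite -[e]invrK lef_pV2 ?posrE ?invr_gt0 ?b_gt0 //.
  rewrite /b; apply: (@le_trans _ _ (norm2 R n `^ alpha)); last first.
    by rewrite lerDr.
  have -> : e^-1 = (e^-1 `^ alpha^-1) `^ alpha.
    by rewrite -powRrM mulVf ?gt_eqF // powRr1 // invr_ge0 ltW.
  apply: ge0_ler_powR; rewrite ?nnegrE ?powR_ge0 ?sqrtr_ge0 ?(ltW a0) //.
  apply: le_trans (norm2_ge R n i).
  apply: (@le_trans _ _ L0%:R); first by rewrite ltW // archi_boundP ?powR_ge0.
  by rewrite -[L0%:R]/(L0%:Z%:~R) ler_int ltW.
have cnt : (\sum_(i < N) (site i \in fset_set (@Lambda d L0)) <=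
            #|` fset_set (@Lambda d L0)|)%N.
  have -> : (\sum_(i < N) (site i \in fset_set (@Lambda d L0)) =
    #|finset (fun i : 'I_N => site i \in fset_set (@Lambda d L0))|)%N.
    rewrite -sum1_card [RHS]big_mkcond /=; apply: eq_bigr => j _.
    by rewrite finset.in_set; case: (_ \in _).
  rewrite cardE -(size_map (@site d L)); apply: uniq_leq_size.
    by rewrite map_inj_uniq ?enum_uniq //; exact: site_inj.
  by move=> m /mapP[j]; rewrite mem_enum finset.in_set => ij ->.
rewrite -(ler_nat R) natr_sum in cnt.
apply: le_trans (lerD (lexx _) cnt).
rewrite mulr_sumr -big_split /=; apply: ler_sum => i _.
have bi0 : 0 <= (b alpha (site i))^-1 by rewrite invr_ge0 ltW ?b_gt0.
have bi1 : (b alpha (site i))^-1 <= 1 by rewrite invf_le1 ?b_gt0 ?b_ge1.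
have [_|/out h] := boolP (site i \in fset_set (@Lambda d L0)); last first.
  by rewrite addr0 expr2 ler_wpM2r.
apply: (@le_trans _ _ 1); first by rewrite exprn_ile1.
by rewrite lerDr mulr_ge0 // ltW.
Qed.

Section inv_b_sums.
Variables (R : realType) (d : nat) (alpha : R).

Lemma sum_inv_b_sqr_ge0 L : 0 <= sum_inv_b_sqr d alpha L.
Proof. by apply: sumr_ge0 => i _; rewrite sqr_ge0. Qed.

Lemma C_seqE L :
  C_seq d alpha L = (count_scale d alpha L)^-1 * sum_inv_b d alpha L.
Proof. by rewrite /C_seq sum_Lambda. Qed.

Hypotheses (d0 : (0 < d)%N) (a0 : 0 < alpha) (ad : alpha < d%:R).

Lemma count_scale_gt0 L : (0 < L)%N -> 0 < count_scale d alpha L.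
Proof. by move=> L0; rewrite powR_gt0 // ltr0n. Qed.

Lemma inv_count_scale_cvg0 : (count_scale d alpha L)^-1 @[L --> \oo] --> 0.
Proof.
have g0 : 0 < d%:R - alpha by rewrite subr_gt0.
apply/cvgrPdist_lt => e e0.
near=> L.
have L0 : (0 < L)%N by near: L; exact: nbhs_infty_gt.
rewrite sub0r normrN ger0_norm ?invr_ge0 ?ltW ?count_scale_gt0 //.
rewrite -[e]invrK ltf_pV2 ?posrE ?invr_gt0 ?count_scale_gt0 //.
have -> : e^-1 = (e^-1 `^ (d%:R - alpha)^-1) `^ (d%:R - alpha).
  by rewrite -powRrM mulVf ?gt_eqF // powRr1 // invr_ge0 ltW.
apply: gt0_ltr_powR; rewrite ?nnegrE ?powR_ge0 //.
by near: L; exact: nbhs_infty_gtr.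
Unshelve. all: by end_near. Qed.

Lemma sum_inv_b_sqr_cvg0 :
  (count_scale d alpha L)^-1 * sum_inv_b_sqr d alpha L @[L --> \oo] --> 0.
Proof.
have [M M0 hM] := sum_inv_b_le d0 a0 ad.
apply/cvgrPdist_le => e e0.
have M1 : 0 < M + 1 by rewrite ltr_wpDl.
pose e1 := e / (2 * (M + 1)).
have e10 : 0 < e1 by rewrite divr_gt0 // mulr_gt0.
have [M' M'0 hM'] := @sum_inv_b_sqr_le R d alpha e1 a0 e10.
have M'1 : 0 < M' + 1 by rewrite ltr_wpDl.
have /cvgrPdist_lt/(_ (e / (2 * (M' + 1)))) := inv_count_scale_cvg0.
move=> /(_ (divr_gt0 e0 (mulr_gt0 (ltr0n _ 2) M'1))) hv.
near=> L.
have L0 : (0 < L)%N by near: L; exact: nbhs_infty_gt.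
have v0 := count_scale_gt0 L0.
have iv0 : 0 <= (count_scale d alpha L)^-1 by rewrite invr_ge0 ltW.
have hvL : `|0 - (count_scale d alpha L)^-1| < e / (2 * (M' + 1)) by near: L.
rewrite sub0r normrN ger0_norm // in hvL.
rewrite sub0r normrN ger0_norm ?mulr_ge0 ?sum_inv_b_sqr_ge0 //.
rewrite mulrC ler_pdivrMr //.
apply: (le_trans (hM' L)).
have h1 : e1 * sum_inv_b d alpha L <= e / 2 * count_scale d alpha L.
  apply: (le_trans (ler_wpM2l (ltW e10) (hM L L0))).
  rewrite mulrA ler_wpM2r ?(ltW v0) // /e1.
  have -> : e / (2 * (M + 1)) * M = (e / 2) * (M / (M + 1)).
    by field; rewrite gt_eqF.
  by rewrite ler_piMr ?divr_ge0 ?(ltW e0) // ler_pdivrMr // mul1r lerDl.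
have h2 : M' <= e / 2 * count_scale d alpha L.
  move: hvL; rewrite ltr_pdivlMr ?mulr_gt0 // mulrC ltr_pdivrMr // => h.
  lra.
lra.
Unshelve. all: by end_near. Qed.

End inv_b_sums.

(** * Counting pairwise independent events *)

Lemma integral_indic_comb (R : realType) (disp : measure_display)
    (Omega : measurableType disp) (P : probability Omega R) (I : finType)
    (c : I -> R) (A : I -> set Omega) :
  (forall i, 0 <= c i) -> (forall i, measurable (A i)) ->
  (\int[P]_w (\sum_i c i * \1_(A i) w)%:E =
   (\sum_i c i * fine (P (A i)))%:E)%E.
Proof.
move=> c0 mA.
have mind i : measurable_fun setT (EFin \o (fun w => c i * \1_(A i) w)).
  apply/measurable_EFinP; exact: measurable_funM.
transitivity (\int[P]_w (\sum_i (c i * \1_(A i) w)%:E))%E.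
  by apply: eq_integral => w _; rewrite -sumEFin.
rewrite ge0_integral_sum //; last first.
  by move=> i w _; rewrite lee_fin mulr_ge0.
rewrite -sumEFin; apply: eq_bigr => i _.
under eq_integral do rewrite EFinM.
rewrite ge0_integralZl_EFin //; last first.
  by apply/measurable_EFinP; exact: measurable_indic.
by rewrite integral_indic // setIT EFinM fineK // fin_num_measure.
Qed.

(** Integrating a pointwise inequality between nonnegative combinations of
    indicators; all moment estimates below are instances, with [F] the event to
    be estimated and [e0] a constant. *)
Lemma probability_comb_le (R : realType) (disp : measure_display)
    (Omega : measurableType disp) (P : probability Omega R) (I J : finType)
    (c : I -> R) (A : I -> set Omega) (e : J -> R) (B : J -> set Omega)
    (c0 e0 : R) (F : set Omega) :
  0 <= c0 -> 0 <= e0 -> measurable F ->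
  (forall i, 0 <= c i) -> (forall i, measurable (A i)) ->
  (forall j, 0 <= e j) -> (forall j, measurable (B j)) ->
  (forall w, c0 * \1_F w + \sum_i c i * \1_(A i) w <=
             e0 + \sum_j e j * \1_(B j) w) ->
  c0 * fine (P F) + \sum_i c i * fine (P (A i)) <=
  e0 + \sum_j e j * fine (P (B j)).
Proof.
move=> c00 e00 mF ci0 mA ej0 mB le.
pose c' (i : option I) := if i is Some i then c i else c0.
pose A' (i : option I) := if i is Some i then A i else F.
pose e' (i : option J) := if i is Some i then e i else e0.
pose B' (i : option J) := if i is Some i then B i else setT.
have optE (K : finType) (f : option K -> R) :
    \sum_i f i = f None + \sum_i f (Some i).
  rewrite (bigD1 None) //=; congr (_ + _).
  rewrite (reindex_omap Some id) => [|[i|] //].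
  by apply: eq_bigl => i; rewrite eqxx.
have -> : c0 * fine (P F) + \sum_i c i * fine (P (A i)) =
          \sum_i c' i * fine (P (A' i)) by rewrite optE.
have -> : e0 + \sum_i e i * fine (P (B i)) =
          \sum_i e' i * fine (P (B' i)).
  by rewrite optE /= probability_setT mulr1.
have c'0 i : 0 <= c' i by case: i.
have e'0 i : 0 <= e' i by case: i.
have mA' i : measurable (A' i) by case: i.
have mB' i : measurable (B' i) by case: i => //; exact: measurableT.
have mcomb (K : finType) (g : K -> R) (C : K -> set Omega) :
    (forall i, measurable (C i)) ->
    measurable_fun setT (EFin \o (fun w => \sum_i g i * \1_(C i) w)).
  move=> mC; apply/measurable_EFinP; apply: measurable_sum => i.
  by apply: measurable_funM => //; exact: measurable_indic.
rewrite -lee_fin -!integral_indic_comb //.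
apply: ge0_le_integral => //.
- by move=> w _; rewrite lee_fin sumr_ge0 // => i _; rewrite mulr_ge0.
- exact: mcomb.
- exact: mcomb.
move=> w _; rewrite lee_fin !optE /=.
by rewrite indicT mulr1; exact: le.
Qed.

Section events.
Variables (R : realType) (disp : measure_display)
  (Omega : measurableType disp) (P : probability Omega R) (I : finType)
  (A : I -> set Omega).
Hypothesis mA : forall i, measurable (A i).

Let count (w : Omega) : R := \sum_i \1_(A i) w.

Let measurable_count : measurable_fun setT count.
Proof. by apply: measurable_sum => i; exact: measurable_indic. Qed.

Lemma measurable_markov_event (t : R) : measurable [set w | t <= count w].
Proof.
have -> : [set w | t <= count w] = count @^-1` `[t, +oo[.
  by apply/seteqP; split => w /=; rewrite in_itv /= andbT.
rewrite -[X in measurable X]setTI; exact: measurable_count.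
Qed.

Lemma markov_count (t : R) : 0 < t ->
  fine (P [set w | t <= count w]) <= t^-1 * \sum_i fine (P (A i)).
Proof.
move=> t0; rewrite mulrC ler_pdivlMr // mulrC.
have : t * fine (P [set w | t <= count w]) +
       \sum_(i : void) 0 * fine (P setT) <= 0 + \sum_i 1 * fine (P (A i)).
  apply: (@probability_comb_le R disp Omega P _ _ (fun=> 0) (fun=> setT)) => //.
  - exact: ltW.
  - exact: measurable_markov_event.
  move=> w; rewrite [X in _ + X]big1 => [|[]//]; rewrite addr0 add0r.
  under eq_bigr do rewrite mul1r.
  rewrite indicE; case: (boolP (w \in _)) => [|_].
    by rewrite inE mulr1.
  by rewrite mulr0; apply: sumr_ge0 => i _; rewrite indicE.
rewrite [X in _ + X]big1 => [|[]//]; rewrite addr0 add0r.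
by under eq_bigr do rewrite mul1r.
Qed.

Let mu : R := \sum_i fine (P (A i)).

Lemma measurable_chebyshev_event (t : R) :
  measurable [set w | t <= `|count w - mu|].
Proof.
have -> : [set w | t <= `|count w - mu|] =
    (fun w => `|count w - mu|) @^-1` `[t, +oo[.
  by apply/seteqP; split => w /=; rewrite in_itv /= andbT.
rewrite -[X in measurable X]setTI.
have h : measurable_fun setT (fun w => `|count w - mu|).
  apply: measurableT_comp => //; apply: measurable_funB => //.
exact: h.
Qed.

(** Pairwise independence removes the covariances, so the variance of the count
    is at most its mean.  The square is expanded so that only nonnegative
    combinations of indicators are integrated. *)
Lemma chebyshev_count (t : R) : 0 < t ->
  (forall i j, i != j ->
    fine (P (A i `&` A j)) = fine (P (A i)) * fine (P (A j))) ->
  fine (P [set w | t <= `|count w - mu|]) <= t ^- 2 * mu.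
Proof.
move=> t0 ind; rewrite mulrC ler_pdivlMr ?exprn_gt0 // mulrC.
have p0 i : 0 <= fine (P (A i)) by rewrite fine_ge0.
have mu0 : 0 <= mu by apply: sumr_ge0.
have : t ^+ 2 * fine (P [set w | t <= `|count w - mu|]) +
       \sum_i (2 * mu) * fine (P (A i)) <=
       mu ^+ 2 + \sum_(p : I * I) 1 * fine (P (A p.1 `&` A p.2)).
  apply: (@probability_comb_le R disp Omega P _ _ (fun=> 2 * mu) A (fun=> 1)
    (fun p => A p.1 `&` A p.2)) => //.
  - exact: sqr_ge0.
  - exact: sqr_ge0.
  - exact: measurable_chebyshev_event.
  - by move=> _; rewrite mulr_ge0.
  - by move=> p; exact: measurableI.
  move=> w.
  have -> : \sum_(p : I * I) 1 * \1_(A p.1 `&` A p.2) w = count w ^+ 2.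
    rewrite -(pair_bigA _ (fun i j => 1 * \1_(A i `&` A j) w)) /=.
    rewrite expr2 /count mulr_suml; apply: eq_bigr => i _.
    rewrite mulr_sumr; apply: eq_bigr => j _.
    by rewrite mul1r indicI.
  rewrite -mulr_sumr -/(count w).
  have sq : 0 <= (count w - mu) ^+ 2 by exact: sqr_ge0.
  rewrite indicE; case: (boolP (w \in _)) => [|_].
    rewrite inE mulr1 /= => tw.
    have : t ^+ 2 <= `|count w - mu| ^+ 2 by rewrite lerXn2r // nnegrE ltW.
    rewrite real_normK ?num_real //; lra.
  rewrite mulr0; lra.
rewrite -mulr_sumr -/mu.
have -> : \sum_(p : I * I) 1 * fine (P (A p.1 `&` A p.2)) =
          \sum_i \sum_j fine (P (A i `&` A j)).
  rewrite -(pair_bigA _ (fun i j => 1 * fine (P (A i `&` A j)))) /=.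
  by apply: eq_bigr => i _; apply: eq_bigr => j _; rewrite mul1r.
have le2 : \sum_i \sum_j fine (P (A i `&` A j)) <= mu ^+ 2 + mu.
  rewrite expr2 {1}/mu mulr_suml -big_split /=; apply: ler_sum => i _.
  rewrite (bigD1 i) //= setIid addrC lerD2r.
  rewrite mulr_sumr [leRHS](bigD1 i) //= ler_wpDl ?mulr_ge0 //.
  by apply: ler_sum => j ji; rewrite ind // eq_sym.
lra.
Qed.

End events.

(** * Uniform variables, independence and almost sure limits *)

Lemma uniform_prob_itvNyc (R : realType) (c : R) : 0 <= c <= 1 ->
  uniform_prob (@ltr01 R) `]-oo, c] = c%:E.
Proof.
move=> /andP[c0 c1]; rewrite /uniform_prob integral_uniform_pdf.
have -> : `]-oo, c] `&` `[0, 1] = `[0, c]%classic :> set R.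
  apply/seteqP; split => x /=; rewrite !in_itv /=.
    by move=> [xc /andP[-> _]].
  by move=> /andP[-> xc]; rewrite xc (le_trans xc c1).
rewrite (eq_integral (fun=> 1%:E)); last first.
  move=> x; rewrite inE /= in_itv /= /uniform_pdf => /andP[-> xc].
  by rewrite (le_trans xc c1) subr0 invr1.
rewrite integral_cst //= mul1e lebesgue_measure_itv /= lte_fin.
have [_|cle0] := ltP 0 c; first by rewrite -EFinB subr0.
by congr (_%:E); apply/eqP; rewrite eq_le c0 cle0.
Qed.

Lemma uniform01_le_ub (R : realType) (disp : measure_display)
    (Omega : measurableType disp) (P : probability Omega R) (X : {RV P >-> R})
    (c : R) : uniform01 X -> 0 <= c ->
  fine (P (X @^-1` `]-oo, c])) <= c.
Proof.
move=> uX c0.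
have pE : P (X @^-1` `]-oo, c]) = uniform_prob (@ltr01 R) `]-oo, c].
  by rewrite -uX //; exact: measurable_itv.
have [c1|/ltW c1] := leP c 1; first by rewrite pE uniform_prob_itvNyc ?c0.
apply: le_trans c1; rewrite -lee_fin fineK ?fin_num_measure //.
  apply: probability_le1; rewrite -[X in measurable X]setTI.
  exact: measurable_funPT.
by rewrite -[X in measurable X]setTI; exact: measurable_funPT.
Qed.

(** For [c > 1] the left-hand side is negative; the quadratic error replaces the
    case distinction in [min c 1]. *)
Lemma uniform01_le_lb (R : realType) (disp : measure_display)
    (Omega : measurableType disp) (P : probability Omega R) (X : {RV P >-> R})
    (c : R) : uniform01 X -> 0 <= c ->
  c - c ^+ 2 <= fine (P (X @^-1` `]-oo, c])).
Proof.
move=> uX c0.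
have pE : P (X @^-1` `]-oo, c]) = uniform_prob (@ltr01 R) `]-oo, c].
  by rewrite -uX //; exact: measurable_itv.
have [c1|/ltW c1] := leP c 1.
  by rewrite pE uniform_prob_itvNyc ?c0 //= lerBlDr lerDl sqr_ge0.
apply: (@le_trans _ _ 0); last by rewrite fine_ge0.
by rewrite subr_le0 expr2 ler_peMr.
Qed.

Lemma mutually_independent_pair (R : realType) (disp : measure_display)
    (Omega : measurableType disp) (P : probability Omega R) (I : choiceType)
    (X : I -> {RV P >-> R}) (A : I -> set R) (i j : I) :
  mutually_independent X -> (forall k, measurable (A k)) -> i != j ->
  P (X i @^-1` A i `&` X j @^-1` A j) =
  (P (X i @^-1` A i) * P (X j @^-1` A j))%E.
Proof.
move=> indep mA ij; have := indep [fset i; j]%fset A mA.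
rewrite big_fsetU1 ?inE //= big_seq_fset1 => <-; congr (P _).
apply/seteqP; split => [w [wi wj] k /=|w h].
  by rewrite !inE => /orP[/eqP ->|/eqP ->].
by split; apply: h; rewrite /= !inE eqxx ?orbT.
Qed.

(** If [Q] failed along infinitely many [L], almost every [w] would lie in [F L]
    for all large [L] of this kind; but each such tail intersection is contained
    in events of arbitrarily small probability. *)
Lemma eventually_of_ae (R : realType) (disp : measure_display)
    (Omega : measurableType disp) (P : probability Omega R)
    (F : nat -> set Omega) (Q : nat -> Prop) :
  (forall L, measurable (F L)) ->
  fine (P (F L)) @[L --> \oo] --> (0 : R) ->
  {ae P, forall w, \forall L \near \oo, F L w \/ Q L} ->
  \forall L \near \oo, Q L.
Proof.
move=> mF F0 ae; apply: contrapT => nQ.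
have inf k : exists L, (k <= L)%N /\ ~ Q L.
  apply: contrapT => h; apply: nQ; exists k => // L /= kL.
  by apply: contrapT => nQL; apply: h; exists L.
pose D k := \bigcap_(L in [set L | (k <= L)%N /\ ~ Q L]) F L.
have mD k : measurable (D k) by exact: bigcap_measurableType.
have D0 k : P (D k) = 0%E.
  apply/eqP; rewrite eq_le measure_ge0 andbT.
  apply/lee_addgt0Pr => e e0; rewrite add0e.
  have /cvgrPdist_lt/(_ e e0)[k' _ hk'] := F0.
  have [L [kL nQL]] := inf (maxn k k').
  have [kL1 kL2] : (k <= L)%N /\ (k' <= L)%N.
    by split; apply: leq_trans kL; rewrite ?leq_maxl ?leq_maxr.
  apply: (@le_trans _ _ (P (F L))).
    by apply: le_measure; rewrite ?inE //; apply: bigcap_inf.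
  rewrite -[P (F L)]fineK ?fin_num_measure // lee_fin ltW //.
  by have := hk' L kL2; rewrite /= sub0r normrN ger0_norm ?fine_ge0.
have nD : P.-negligible (\bigcup_k D k).
  apply: negligible_bigcup => k.
  by apply/negligibleP; [exact: mD|exact: D0].
have [B [mB B0 sB]] := negligibleU ae nD.
suff BT : B = setT.
  have := probability_setT P; rewrite -BT B0 => /eqP.
  by rewrite eqe eq_sym oner_eq0.
rewrite -subTset => w _; apply: sB.
have [[k _ hk]|h] := pselect (\forall L \near \oo, F L w \/ Q L); last by left.
by right; exists k => // L [kL nQL]; have [] := hk L kL.
Qed.

(** * Low sites and low pairs as events *)

Section low_events.
Variables (R : realType) (disp : measure_display)
  (Omega : measurableType disp) (P : probability Omega R)
  (d : nat) (alpha : R) (q : 'rV[int]_d -> {RV P >-> R}).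

Definition low_event (a : R) (n : 'rV[int]_d) : set Omega :=
  [set w | b alpha n * q n w <= a].

(** Empty for pairs that are not adjacent, so that the family can be indexed by
    all pairs. *)
Definition low_pair_event (a : R) (L : nat)
    (p : 'I_#|{: fset_set (@Lambda d L)}| * 'I_#|{: fset_set (@Lambda d L)}|) :
    set Omega :=
  if site_adj p.1 p.2 then low_event a (site p.1) `&` low_event a (site p.2)
  else set0.

Lemma low_eventE a n : low_event a n = q n @^-1` `]-oo, a * (b alpha n)^-1].
Proof.
apply/seteqP; split => w;
  by rewrite /low_event /= in_itv /= ler_pdivlMr ?b_gt0 // mulrC.
Qed.

Lemma measurable_low_event a n : measurable (low_event a n).
Proof.
by rewrite low_eventE -[X in measurable X]setTI; exact: measurable_funPT.
Qed.

Lemma measurable_low_pair_event a L p : measurable (@low_pair_event a L p).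
Proof.
rewrite /low_pair_event; case: ifP => _ //.
by apply: measurableI; exact: measurable_low_event.
Qed.

Lemma card_low_sites a L w :
  #|low_sites (@site_potential R d alpha (fun n => q n w) L) a|%:R =
  \sum_(i < #|{: fset_set (@Lambda d L)}|) \1_(low_event a (site i)) w :> R.
Proof.
rewrite -sum1_card natr_sum big_mkcond /=; apply: eq_bigr => i _.
rewrite indicE finset.in_set /site_potential.
have -> : (w \in low_event a (site i)) =
    (b alpha (site i) * q (site i) w <= a) by apply/idP/idP; rewrite inE.
by case: (_ <= _).
Qed.

Lemma card_low_pairs a L w :
  #|low_pairs (@site_adj d L)
      (@site_potential R d alpha (fun n => q n w) L) a|%:R =
  \sum_p \1_(@low_pair_event a L p) w :> R.
Proof.
rewrite -sum1_card natr_sum big_mkcond /=; apply: eq_bigr => p _.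
rewrite indicE finset.in_set /site_potential /low_pair_event.
case: (site_adj p.1 p.2) => /=; last by rewrite in_set0.
rewrite in_setI.
have E i : (w \in low_event a (site i)) =
    (b alpha (site i) * q (site i) w <= a) by apply/idP/idP; rewrite inE.
by rewrite !E; case: (_ && _).
Qed.

Hypotheses (q_indep : mutually_independent q)
  (q_unif : forall n, uniform01 (q n)).

Lemma low_event_le a n : 0 <= a ->
  fine (P (low_event a n)) <= a * (b alpha n)^-1.
Proof.
move=> a0; rewrite low_eventE; apply: uniform01_le_ub => //.
by rewrite divr_ge0 // ltW // b_gt0.
Qed.

Lemma low_event_ge a n : 0 <= a ->
  a * (b alpha n)^-1 - a ^+ 2 * (b alpha n)^-1 ^+ 2 <= fine (P (low_event a n)).
Proof.
move=> a0; rewrite low_eventE -exprMn; apply: uniform01_le_lb => //.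
by rewrite divr_ge0 // ltW // b_gt0.
Qed.

Lemma low_event_indep a n m : n != m ->
  fine (P (low_event a n `&` low_event a m)) =
  fine (P (low_event a n)) * fine (P (low_event a m)).
Proof.
move=> nm; rewrite -fineM ?fin_num_measure //; try exact: measurable_low_event.
rewrite !low_eventE; congr fine.
exact: (@mutually_independent_pair _ _ _ _ _ _
  (fun k => `]-oo, a * (b alpha k)^-1]%classic)).
Qed.

Definition low_mean (a : R) (L : nat) : R :=
  \sum_(i < #|{: fset_set (@Lambda d L)}|) fine (P (low_event a (site i))).

Lemma low_mean_le a L : 0 <= a -> low_mean a L <= a * sum_inv_b d alpha L.
Proof.
move=> a0; rewrite mulr_sumr; apply: ler_sum => i _; exact: low_event_le.
Qed.

Lemma low_mean_ge a L : 0 <= a ->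
  a * sum_inv_b d alpha L - a ^+ 2 * sum_inv_b_sqr d alpha L <= low_mean a L.
Proof.
move=> a0; rewrite !mulr_sumr -sumrB; apply: ler_sum => i _.
exact: low_event_ge.
Qed.

(** By independence a pair contributes at most [(a / b n) * (a / b m)], hence at
    most half the sum of the squares; each site belongs to at most [2d] pairs on
    each side. *)
Lemma low_pair_mean_le a L : 0 <= a ->
  \sum_p fine (P (@low_pair_event a L p)) <=
  (2 * d)%:R * a ^+ 2 * sum_inv_b_sqr d alpha L.
Proof.
move=> a0.
pose g (i : 'I_#|{: fset_set (@Lambda d L)}|) := (b alpha (site i))^-1 ^+ 2.
have half : \sum_i \sum_j (site_adj i j)%:R * (a ^+ 2 * g i / 2) <=
            (2 * d)%:R * a ^+ 2 * sum_inv_b_sqr d alpha L / 2.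
  rewrite mulr_sumr mulr_suml; apply: ler_sum => i _.
  rewrite -mulr_suml -/(g i).
  have -> : (2 * d)%:R * a ^+ 2 * g i / 2 = (2 * d)%:R * (a ^+ 2 * g i / 2).
    by ring.
  rewrite ler_wpM2r ?site_degree // divr_ge0 // mulr_ge0 ?sqr_ge0 //.
apply: (@le_trans _ _ (\sum_(p : _ * _)
    ((site_adj p.1 p.2)%:R * (a ^+ 2 * g p.1 / 2) +
     (site_adj p.1 p.2)%:R * (a ^+ 2 * g p.2 / 2)))).
  apply: ler_sum => -[i j] _; rewrite /low_pair_event /=.
  case: (boolP (site_adj i j)) => [ij|_]; last by rewrite measure0 !mul0r addr0.
  have nij : site i != site j.
    apply/eqP => e; move: ij; rewrite /site_adj /= e subrr /norm1 big1 //.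
    by move=> k _; rewrite mxE normr0.
  rewrite low_event_indep // !mul1r /g.
  set x := (b alpha (site i))^-1; set y := (b alpha (site j))^-1.
  have hx : fine (P (low_event a (site i))) <= a * x by exact: low_event_le.
  have hy : fine (P (low_event a (site j))) <= a * y by exact: low_event_le.
  apply: (le_trans (ler_pM _ _ hx hy)); rewrite ?fine_ge0 //.
  have := sqr_ge0 (a * x - a * y); lra.
rewrite -(pair_bigA _ (fun i j => (site_adj i j)%:R * (a ^+ 2 * g i / 2)
   + (site_adj i j)%:R * (a ^+ 2 * g j / 2))) /=.
under eq_bigr do rewrite big_split /=.
rewrite big_split /= [X in _ + X]exchange_big /=.
under [X in _ + X]eq_bigr do under eq_bigr do rewrite site_adj_sym.
apply: (le_trans (lerD half half)); lra.
Qed.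

End low_events.

(** * Comparison of the eigenvalue count with its deterministic profile *)

Section bad_event.
Variables (R : realType) (disp : measure_display)
  (Omega : measurableType disp) (P : probability Omega R)
  (d : nat) (alpha : R) (q : 'rV[int]_d -> {RV P >-> R}).

Let count (a : R) (L : nat) (w : Omega) : R :=
  \sum_(i < #|{: fset_set (@Lambda d L)}|) \1_(low_event alpha q a (site i)) w.

Let pairs (a : R) (L : nat) (w : Omega) : R :=
  \sum_p \1_(@low_pair_event _ _ _ _ _ alpha q a L p) w.

Definition deviation_event (a t : R) (L : nat) : set Omega :=
  [set w | t * count_scale d alpha L <= `|count a L w - low_mean alpha q a L|].

Definition many_pairs_event (a t : R) (L : nat) : set Omega :=
  [set w | t * count_scale d alpha L <= pairs a L w].

Lemma measurable_deviation_event a t L : measurable (deviation_event a t L).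
Proof.
by apply: measurable_chebyshev_event => i; exact: measurable_low_event.
Qed.

Lemma measurable_many_pairs_event a t L : measurable (many_pairs_event a t L).
Proof.
by apply: measurable_markov_event => i; exact: measurable_low_pair_event.
Qed.

Hypotheses (d0 : (0 < d)%N) (a0 : 0 < alpha) (ad : alpha < d%:R).
Hypotheses (q_indep : mutually_independent q)
  (q_unif : forall n, uniform01 (q n)).

(** Chebyshev's bound is of order [count_scale / count_scale^2]. *)
Lemma deviation_event_cvg0 a t : 0 <= a -> 0 < t ->
  fine (P (deviation_event a t L)) @[L --> \oo] --> (0 : R).
Proof.
move=> a_ge0 t0.
have [M M0 hM] := sum_inv_b_le d0 a0 ad.
apply: (@squeeze_cvgr _ _ _ _ (fun=> 0)
    (fun L => t ^- 2 * a * M * (count_scale d alpha L)^-1)); last 2 first.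
- exact: cvg_cst.
- rewrite -[X in _ --> X](mulr0 (t ^- 2 * a * M)); apply: cvgMr.
  exact: inv_count_scale_cvg0.
near=> L.
have L0 : (0 < L)%N by near: L; exact: nbhs_infty_gt.
have v0 := count_scale_gt0 d alpha L0.
rewrite fine_ge0 //=.
have tv0 : 0 < t * count_scale d alpha L by rewrite mulr_gt0.
apply: le_trans (chebyshev_count _ tv0 _) _.
- by move=> i; exact: measurable_low_event.
- move=> i j ij; apply: low_event_indep => //.
  by apply: contra ij => /eqP/site_inj ->.
rewrite -/(low_mean alpha q a L).
have mL : low_mean alpha q a L <= a * (M * count_scale d alpha L).
  apply: le_trans (low_mean_le alpha q_unif L a_ge0) _.
  by rewrite ler_wpM2l // hM.
have tv2 : 0 <= (t * count_scale d alpha L) ^- 2 by rewrite invr_ge0 sqr_ge0.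
apply: le_trans (ler_wpM2l tv2 mL) _.
rewrite le_eqVlt; apply/orP; left; apply/eqP.
by field; rewrite !gt_eqF.
Unshelve. all: by end_near. Qed.

(** Markov's bound is of order [sum_inv_b_sqr / count_scale]. *)
Lemma many_pairs_event_cvg0 a t : 0 <= a -> 0 < t ->
  fine (P (many_pairs_event a t L)) @[L --> \oo] --> (0 : R).
Proof.
move=> a_ge0 t0.
apply: (@squeeze_cvgr _ _ _ _ (fun=> 0)
    (fun L => t^-1 * ((2 * d)%:R * a ^+ 2) *
      ((count_scale d alpha L)^-1 * sum_inv_b_sqr d alpha L))); last 2 first.
- exact: cvg_cst.
- rewrite -[X in _ --> X](mulr0 (t^-1 * ((2 * d)%:R * a ^+ 2))); apply: cvgMr.
  exact: sum_inv_b_sqr_cvg0.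
near=> L.
have L0 : (0 < L)%N by near: L; exact: nbhs_infty_gt.
have v0 := count_scale_gt0 d alpha L0.
rewrite fine_ge0 //=.
have tv0 : 0 < t * count_scale d alpha L by rewrite mulr_gt0.
apply: le_trans (markov_count _ _ tv0) _.
  by move=> p; exact: measurable_low_pair_event.
have tv1 : 0 <= (t * count_scale d alpha L)^-1 by rewrite invr_ge0 ltW.
have mean := low_pair_mean_le alpha q_indep q_unif L a_ge0.
apply: le_trans (ler_wpM2l tv1 mean) _.
rewrite le_eqVlt; apply/orP; left; apply/eqP.
by field; rewrite !gt_eqF.
Unshelve. all: by end_near. Qed.

(** Outside the exceptional events, one [t] pays for the deviation of the number
    of low sites and one for the low pairs. *)
Lemma scaled_count_bounds (a e t : R) L w : (0 < L)%N -> 0 < a -> 0 < e ->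
  ~ (deviation_event a t L `|` deviation_event (a + e) t L `|`
     many_pairs_event (high_level (2 * d)%:R a e) t L) w ->
  a * C_seq d alpha L -
    a ^+ 2 * ((count_scale d alpha L)^-1 * sum_inv_b_sqr d alpha L) - 2 * t <=
  scaled_count alpha (fun n => q n w) ((2 * d)%:R + a) L <=
  (a + e) * C_seq d alpha L + 2 * t.
Proof.
move=> L0 a_gt0 e0 /not_orP[/not_orP[/negP + /negP +] /negP].
rewrite /deviation_event /many_pairs_event /= -!ltNge.
set K := high_level _ a e => dev1 dev2 mp.
have v0 := count_scale_gt0 d alpha L0.
set V := count_scale d alpha L in v0 dev1 dev2 mp *.
pose pot := @site_potential R d alpha (fun n => q n w) L.
have D0 : 0 <= (2 * d)%:R :> R by [].
have aK : a <= K by exact: high_level_ge.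
have low := low_sites_le_eigen_count (2 * d)%:R pot (@site_adj_sym d L) aK.
have up := eigen_count_le_low_sites pot a (@site_adj_sym d L) D0 e0
  (@site_degree R d L).
move: low up; rewrite -schrodinger_boxE /scaled_count.
rewrite -/(count_scale d alpha L) -/V.
set N := eigen_count _ _.
rewrite -2!(ler_nat R) (natrD _ N) (natrD _ #|low_sites pot (a + e)|).
rewrite !card_low_sites !card_low_pairs -/K.
rewrite -/(count a L w) -/(count (a + e) L w) -/(pairs K L w) => low up.
have mean1 := low_mean_ge alpha q_unif L (ltW a_gt0).
have mean2 := low_mean_le alpha q_unif L (ltW (addr_gt0 a_gt0 e0)).
move: dev1 dev2; rewrite !ltr_norml => /andP[dev1 _] /andP[_ dev2].
set sV := V^-1 * _.
pose cV := C_seq d alpha L * V.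
have SVc : sum_inv_b d alpha L = cV.
  by rewrite /cV C_seqE -/V mulrC mulrA mulfV ?gt_eqF // mul1r.
have S2V : sum_inv_b_sqr d alpha L = sV * V.
  by rewrite /sV -mulrA mulrCA mulVf ?gt_eqF // mulr1.
rewrite ler_pdivlMr // ler_pdivrMr //.
rewrite SVc in mean1 mean2.
have -> : (a * C_seq d alpha L - a ^+ 2 * sV - 2 * t) * V =
          a * cV - a ^+ 2 * (sV * V) - 2 * (t * V) by rewrite /cV; ring.
have -> : ((a + e) * C_seq d alpha L + 2 * t) * V = (a + e) * cV + 2 * (t * V).
  by rewrite /cV; ring.
rewrite S2V in mean1.
by apply/andP; split; lra.
Qed.

(** The two-sided bound compares the limit [x] with a deterministic sequence, so
    that it holds for all large [L] once it holds outside events of vanishing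
    probability. *)
Lemma scaled_count_limit (E x : R) : (2 * d)%:R < E ->
  {ae P, forall w, scaled_count alpha (fun n => q n w) E L
    @[L --> \oo] --> x} ->
  (E - (2 * d)%:R) * C_seq d alpha L @[L --> \oo] --> x.
Proof.
rewrite -subr_gt0; have : (2 * d)%:R + (E - (2 * d)%:R) = E.
  by rewrite addrC subrK.
move: (E - _) => a aE a_gt0 ae.
have [M M0 hM] := sum_inv_b_le d0 a0 ad.
apply/cvgrPdist_le => h h0.
(* the two-sided bound loses at most [4 * t] and [e * C_seq], where
   [C_seq <= M] *)
pose t := h / 8.
have t0 : 0 < t by rewrite divr_gt0.
have M1 : 0 < M + 1 by rewrite ltr_wpDl.
pose e := h / (4 * (M + 1)).
have e0 : 0 < e by rewrite divr_gt0 // mulr_gt0.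
have eM : e * M <= h / 4.
  have -> : e * M = h / 4 * (M / (M + 1)) by rewrite /e; field; rewrite gt_eqF.
  by rewrite ler_piMr ?divr_ge0 ?(ltW h0) // ler_pdivrMr // mul1r lerDl.
pose K := high_level (2 * d)%:R a e.
have K0 : 0 <= K by rewrite (le_trans (ltW a_gt0)) // high_level_ge.
pose F L := deviation_event a t L `|` deviation_event (a + e) t L `|`
     many_pairs_event K t L.
have mF L : measurable (F L).
  by apply: measurableU; [apply: measurableU|];
    [exact: measurable_deviation_event|exact: measurable_deviation_event|
     exact: measurable_many_pairs_event].
have F0 : fine (P (F L)) @[L --> \oo] --> (0 : R).
  have c1 := deviation_event_cvg0 (ltW a_gt0) t0.
  have c2 := deviation_event_cvg0 (ltW (addr_gt0 a_gt0 e0)) t0.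
  have c3 := many_pairs_event_cvg0 K0 t0.
  have c := cvgD (cvgD c1 c2) c3; rewrite !addr0 in c.
  apply: (@squeeze_cvgr _ _ _ _ (fun=> 0) (fun L =>
    fine (P (deviation_event a t L)) + fine (P (deviation_event (a + e) t L)) +
    fine (P (many_pairs_event K t L)))); [|exact: cvg_cst|exact: c].
  near=> L; rewrite fine_ge0 //=.
  have mD1 := measurable_deviation_event a t L.
  have mD2 := measurable_deviation_event (a + e) t L.
  have mM := measurable_many_pairs_event K t L.
  rewrite -lee_fin !EFinD !fineK ?fin_num_measure //.
  apply: le_trans (measureU2 _ _ _) _ => //; first exact: measurableU.
  by rewrite leeD2r //; apply: measureU2.
have key : \forall L \near \oo, `|x - a * C_seq d alpha L| <= h.
  apply: (eventually_of_ae mF F0).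
  apply: filterS ae => w /cvgrPdist_lt/(_ t t0) cv.
  have s2 := sum_inv_b_sqr_cvg0 d0 a0 ad.
  have a2 : 0 < a ^+ 2 + 1 by rewrite ltr_wpDl // sqr_ge0.
  have /cvgrPdist_lt/(_ (t / (a ^+ 2 + 1)) (divr_gt0 t0 a2)) s2' := s2.
  near=> L.
  have L0 : (0 < L)%N by near: L; exact: nbhs_infty_gt.
  have [FL|nFL] := pselect (F L w); [by left|right].
  have /andP[lo up] := scaled_count_bounds L0 a_gt0 e0 nFL.
  rewrite aE in lo up.
  have cvL : `|x - scaled_count alpha (fun n => q n w) E L| < t.
    by near: L.
  have s2L : `|0 - (count_scale d alpha L)^-1 * sum_inv_b_sqr d alpha L| <
             t / (a ^+ 2 + 1) by near: L.
  have sq := sqr_ge0 a.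
  have v0 := count_scale_gt0 d alpha L0.
  rewrite sub0r normrN ger0_norm in s2L; last first.
    by rewrite mulr_ge0 ?sum_inv_b_sqr_ge0 // invr_ge0 ltW.
  set s := (count_scale d alpha L)^-1 * sum_inv_b_sqr d alpha L in lo s2L.
  have as2 : a ^+ 2 * s <= t.
    rewrite ltr_pdivlMr // in s2L.
    have s0 : 0 <= s by rewrite mulr_ge0 ?sum_inv_b_sqr_ge0 // invr_ge0 ltW.
    lra.
  have eC : e * C_seq d alpha L <= h / 4.
    apply: le_trans eM; rewrite ler_pM2l //.
    by rewrite C_seqE mulrC ler_pdivrMr // hM.
  move: cvL; rewrite ltr_norml ler_norml => /andP[x1 x2].
  have te : t = h / 8 by [].
  rewrite mulrDl in up.
  by apply/andP; split; lra.
by [].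
Unshelve. all: by end_near. Qed.

End bad_event.

Unset Implicit Arguments.

Theorem theorem1p4 (R : realType) (disp : measure_display)
    (Omega : measurableType disp) (P : probability Omega R)
    (d : nat) (alpha : R) (q : 'rV[int]_d -> {RV P >-> R}) (N1 : R -> R)
    (d_ge1 : (1 <= d)%N) (alpha_gt0 : 0 < alpha) (alpha_ltd : alpha < d%:R)
    (q_indep : mutually_independent q)
    (q_unif : forall n : 'rV[int]_d, uniform01 (q n))
    (N1_def : is_N1 alpha q N1) :
  exists C : R, (C_seq d alpha L @[L --> \oo] --> C) /\
    (forall x : R, (2 * d)%:R < x -> N1 x = C * (x - (2 * d)%:R)).
Proof.
have lim (x : R) : (2 * d)%:R < x ->
    C_seq d alpha L @[L --> \oo] --> N1 x / (x - (2 * d)%:R).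
  move=> dx; have a_gt0 : 0 < x - (2 * d)%:R by rewrite subr_gt0.
  have h := scaled_count_limit d_ge1 alpha_gt0 alpha_ltd q_indep q_unif dx
    (N1_def.2 x dx).
  rewrite mulrC.
  have -> : C_seq d alpha = (fun L => (x - (2 * d)%:R)^-1 *
      ((x - (2 * d)%:R) * C_seq d alpha L)).
    by apply/funext => L; rewrite mulrA mulVf ?gt_eqF // mul1r.
  exact: cvgMr.
have d1 : (2 * d)%:R < (2 * d)%:R + 1 :> R by rewrite ltrDl.
(* every energy above [2 * d] gives the same constant *)
exists (N1 ((2 * d)%:R + 1) / ((2 * d)%:R + 1 - (2 * d)%:R)); split.
  exact: lim.
move=> x dx; have a_gt0 : 0 < x - (2 * d)%:R by rewrite subr_gt0.
by rewrite (cvg_unique _ (lim _ d1) (lim x dx)) // divfK // gt_eqF.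
Qed.
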